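(* Let $e\ge 0$ and $t>1$ be integers and $q=(2e+1)t$. For every $C\in PL^{\infty}(2,e,q)$ there exist $a\in\mathbb{Z}_q$ and a function $h:\mathbb{Z}_t\to\mathbb{Z}_q$ such that $C=C_1(a,h)$ or $C=C_2(a,h)$, where $$C_1(a,h)=\{(h(k)+(2e+1)s,\ a+(2e+1)k): k,s\in\mathbb{Z}_t\},$$ $$C_2(a,h)=\{(a+(2e+1)k,\ h(k)+(2e+1)s): k,s\in\mathbb{Z}_t\}.$$
   Context: $\mathbb{Z}_m$ denotes the integers modulo $m$. For $a\in\mathbb{Z}_q$ with representative $\tilde a\in\{0,\dots,q-1\}$ put $|a|_1=\min\{\tilde a,q-\tilde a\}$. The maximum metric on $\mathbb{Z}_q^n$ is $d(x,y)=\max_{1\le i\le n}|x_i-y_i|_1$, and $B(x,r)=\{y\in\mathbb{Z}_q^n: d(x,y)\le r\}$. $PL^{\infty}(n,e,q)$ is the set of perfect codes with packing radius $e$, i.e. of subsets $C\subseteq\mathbb{Z}_q^n$ with $\#C>1$ such that $\mathbb{Z}_q^n$ is the disjoint union of the balls $B(c,e)$, $c\in C$. Since $(2e+1)t=q$, for $k\in\mathbb{Z}_t$ the expression $(2e+1)k$ is a well-defined element of $\mathbb{Z}_q$. *)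

(* Defs.v *)
From HB Require Import structures.
From mathcomp Require Import all_boot all_order all_algebra.

Set Implicit Arguments.
Unset Strict Implicit.
Unset Printing Implicit Defensive.

Import GRing.Theory.
Local Open Scope ring_scope.

(* Pitfall: 'Z_m is the ring of integers modulo m only for 1 < m. *)

Definition lee_abs (q : nat) (a : 'Z_q) : nat := minn a (q - a)%N.

Definition maxdist (n q : nat) (x y : 'rV['Z_q]_n) : nat :=
  \max_(i < n) lee_abs (x ord0 i - y ord0 i)%R.

Definition maxball (n q : nat) (x : 'rV['Z_q]_n) (r : nat) :
    {set 'rV['Z_q]_n} :=
  [set y | (maxdist x y <= r)%N].

(* C \in PL^oo(n, e, q). *)
Definition perfect_code (n e q : nat) (C : {set 'rV['Z_q]_n}) : Prop :=
  [/\ (1 < #|C|)%N,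
      \bigcup_(c in C) maxball c e = [set: 'rV['Z_q]_n]
    & {in C &, forall c c', c != c' ->
         [disjoint maxball c e & maxball c' e]}].

(* (2e+1)k \in Z_q for k \in Z_t, computed from the representative of k in
   {0, .., t-1}; scale_modE shows that any other representative may be used
   when q = (2e+1)t. *)
Definition scale (e t q : nat) (k : 'Z_t) : 'Z_q := ((2 * e + 1) * k)%:R.

Lemma scale_modE (e t q : nat) (ht : (1 < t)%N) (hq : q = ((2 * e + 1) * t)%N)
    (m : nat) :
  scale e q (m%:R : 'Z_t) = ((2 * e + 1) * m)%:R.
Proof.
have hq1 : (1 < q)%N.
  by rewrite hq (leq_trans ht) // leq_pmull // addn1.
apply: ord_inj; rewrite /scale !val_Zp_nat // hq.
by rewrite -!muln_modr modn_mod.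
Qed.

Definition point2 (q : nat) (x y : 'Z_q) : 'rV['Z_q]_2 :=
  \row_(j < 2) (if j == ord0 then x else y).

Definition code1 (e t q : nat) (a : 'Z_q) (h : 'Z_t -> 'Z_q) :
    {set 'rV['Z_q]_2} :=
  [set point2 (h k + scale e q s) (a + scale e q k) | k : 'Z_t, s : 'Z_t].

Definition code2 (e t q : nat) (a : 'Z_q) (h : 'Z_t -> 'Z_q) :
    {set 'rV['Z_q]_2} :=
  [set point2 (a + scale e q k) (h k + scale e q s) | k : 'Z_t, s : 'Z_t].

(* Main.v *)
Require Import Defs.
From HB Require Import structures.
From mathcomp Require Import all_boot all_order all_algebra.
From mathcomp Require Import zify ring.

(** A perfect code in dimension two is a tiling of the discrete torus
    [Z_q x Z_q] by squares of odd side [w = 2e + 1]; the code words are the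
    centres of the squares.

    A vertical line is cut by the squares that meet it into consecutive
    intervals of length [w]. Hence the second coordinates of the centres of
    these squares form a full coset of [w Z_q] ([column_translate],
    [column_congr]), and likewise for horizontal lines and first coordinates.

    The coset attached to a vertical line may depend on the line. If it does
    not, then all centres have second coordinates congruent modulo [w].
    Otherwise it changes between two neighbouring lines [x] and [x + 1]; no
    square can meet both, so every square meeting the line [x] ends there and
    its centre has first coordinate [x - e]. Every horizontal line crosses one
    of these squares, so the coset attached to every horizontal line is that
    of [x - e]: all centres have first coordinates congruent modulo [w]
    ([congr_first_or_second]).

    Suppose that the first coordinates are congruent. A square meeting the
    vertical line through [a + w k], where [a] is one of them, is then centred
    on this line, because offsets of absolute value at most [e] that are
    divisible by [w] vanish. So the centres lie on the [t] lines [a + w k], and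
    on each of them they form a coset of [w Z_q], of which [h k] is a
    representative ([congr_first_param]). This is the second family of codes;
    exchanging the two coordinates gives the first. *)

Set Implicit Arguments.
Unset Strict Implicit.
Unset Printing Implicit Defensive.

Import GRing.Theory.
Local Open Scope ring_scope.

(** * Intervals of odd length on a discrete circle *)

Section SquareTilings.

Variables (e t q : nat).
Hypotheses (t_gt1 : (1 < t)%N) (q_def : q = ((2 * e + 1) * t)%N).

Local Notation w := (2 * e + 1)%N.

Lemma width_lt_modulus : (w < q)%N.
Proof. by nia. Qed.

Lemma modulus_gt1 : (1 < q)%N.
Proof. by have := width_lt_modulus; lia. Qed.

Lemma natr_modulus : q%:R = 0 :> 'Z_q.
Proof. by apply: val_inj; rewrite /= val_Zp_nat ?modulus_gt1 // modnn. Qed.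

Lemma eqr_nat_modulus (m n : nat) : m%:R = n%:R :> 'Z_q -> m = n %[mod q].
Proof.
by move/(congr1 (fun x : 'Z_q => x : nat)); rewrite !val_Zp_nat ?modulus_gt1.
Qed.

Lemma natr_inj_lt (m n : nat) :
  (m < q)%N -> (n < q)%N -> m%:R = n%:R :> 'Z_q -> m = n.
Proof. by move=> ltm ltn /eqr_nat_modulus; rewrite !modn_small. Qed.

Definition near (a x : 'Z_q) : bool := (lee_abs (a - x)%R <= e)%N.

(** Measuring positions from the left end [a - e] of the interval replaces the
    two-sided distance by a single natural offset. *)
Lemma nearP (a x : 'Z_q) :
  reflect (exists2 j, (j <= 2 * e)%N & x + e%:R = a + j%:R) (near a x).
Proof.
have q1 := modulus_gt1; have wq := width_lt_modulus.
apply: (iffP idP) => [|[j le_j def_x]]; rewrite /near /lee_abs.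
  have := ltn_ord (a - x); have := natr_Zp (a - x).
  set n := nat_of_ord (a - x) => def_n lt_n; rewrite geq_min => /orP[le_n|le_n].
    exists (e - n)%N; first by lia.
    by rewrite natrB // def_n; ring.
  have lt_nq : (n < q)%N by move: lt_n; rewrite Zp_cast.
  exists (e + (q - n))%N; first by lia.
  by rewrite natrD natrB 1?ltnW // natr_modulus def_n; ring.
rewrite -(addrK e%:R x) def_x; case: (leqP j e) => [le_je|lt_ej].
  have ->: a - (a + j%:R - e%:R) = (e - j)%:R by rewrite natrB //; ring.
  rewrite val_Zp_nat // modn_small; lia.
have ->: a - (a + j%:R - e%:R) = (q - (j - e))%:R.
  rewrite natrB; last by lia.
  by rewrite natr_modulus natrB 1?ltnW //; ring.
rewrite val_Zp_nat // modn_small; lia.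
Qed.

Lemma near_refl (a : 'Z_q) : near a a.
Proof. by apply/nearP; exists e; rewrite ?leq_pmull. Qed.

(** Congruence modulo [w] on [Z_q] makes sense because [w] divides [q]; the
    quotient ranges over [Z_q] rather than over the naturals so that symmetry
    and transitivity are ring identities. *)
Definition congr_width (x y : 'Z_q) : bool :=
  [exists z : 'Z_q, y == x + w%:R * z].

Lemma congr_widthP (x y : 'Z_q) :
  reflect (exists z, y = x + w%:R * z) (congr_width x y).
Proof. exact: 'exists_eqP. Qed.

Lemma congr_width_sym : symmetric congr_width.
Proof.
suff sub x y : congr_width x y -> congr_width y x.
  by move=> x y; apply/idP/idP; apply: sub.
by case/congr_widthP=> z ->; apply/congr_widthP; exists (- z); ring.
Qed.

Lemma congr_width_trans : transitive congr_width.
Proof.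
move=> y x z /congr_widthP[u ->] /congr_widthP[v ->].
by apply/congr_widthP; exists (u + v); ring.
Qed.

Lemma congr_width_scale (x y : 'Z_q) :
  reflect (exists k : 'Z_t, y = x + scale e q k) (congr_width x y).
Proof.
apply: (iffP (congr_widthP x y)) => [[z ->]|[k ->]].
  by exists (z%:R); rewrite (scale_modE t_gt1 q_def) natrM natr_Zp.
by exists k%:R; rewrite /scale natrM.
Qed.

(** The offset [j] of [x] in the interval around [a] satisfies [j <= 2e] and
    [j = e] modulo [w], so [x] is the midpoint. *)
Lemma near_congr_width_eq (a x : 'Z_q) : near a x -> congr_width a x -> a = x.
Proof.
move=> /nearP[j le_j def_x] /congr_widthP[z eq_x].
have /eqr_nat_modulus : (w * z + e)%:R = j%:R :> 'Z_q.
  by apply: (addrI a); rewrite -def_x eq_x natrD natrM natr_Zp; ring.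
(* The congruence modulo [q] descends to the divisor [w]. *)
move/(congr1 (modn^~ w)); rewrite !modn_dvdm ?q_def ?dvdn_mulr //.
rewrite mulnC modnMDl !modn_small; try lia.
by move=> def_e; apply: (addIr e%:R); rewrite def_x def_e.
Qed.

(** The intervals around the points [b + w s] cover the circle: divide the
    distance from [b - e] to [y] by [w]; the quotient selects the interval and
    the remainder is the offset in it. *)
Lemma near_some_translate (b y : 'Z_q) : exists s : nat, near (b + (w * s)%:R) y.
Proof.
pose n := nat_of_ord (y - b + e%:R); exists (n %/ w)%N; apply/nearP; exists (n %% w)%N.
  by have := @ltn_pmod n w; lia.
have -> : y + e%:R = b + n%:R by rewrite /n natr_Zp; ring.
by rewrite {1}(divn_eq n w) natrD mulnC addrA.
Qed.

(** * Tilings of the torus by squares *)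

(** A code is viewed as a relation between coordinates, so that exchanging the
    axes, under which tilings are stable, is a swap of arguments. *)
Record square_tiling (P : rel 'Z_q) : Prop := SquareTiling {
  tiling_cover : forall x y, exists a b, [/\ P a b, near a x & near b y];
  tiling_unique : forall a b a' b' x y, P a b -> P a' b' ->
    near a x -> near b y -> near a' x -> near b' y -> a = a' /\ b = b'
}.

Lemma square_tiling_swap (P : rel 'Z_q) :
  square_tiling P -> square_tiling (fun x y => P y x).
Proof.
case=> cover unique; split=> [x y|a b a' b' x y Pab Pab' ax bx ax' bx'].
  by have [a [b [Pab ay bx]]] := cover y x; exists b, a.
by have [] := unique _ _ _ _ _ _ Pab Pab' bx ax bx' ax'.
Qed.

Section Columns.

Variables (P : rel 'Z_q) (tilP : square_tiling P).

(** Consider the square covering the first point [b + e + 1] of the column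
    above the given square. Its interval starts exactly at that point, since
    otherwise both squares would contain [b + e]. *)
Lemma column_step (x a b : 'Z_q) :
  P a b -> near a x -> exists2 a', P a' (b + w%:R) & near a' x.
Proof.
move=> Pab ax; have [a' [b' [Pab' ax' /nearP[j le_j def_b']]]] :=
  tiling_cover tilP x (b + (e + 1)%:R).
(* [j] is the offset of [b + e + 1] in the interval around [b']. *)
case: j => [|j] in le_j def_b' *.
  exists a' => //; suff <- : b' = b + w%:R by [].
  by rewrite -(addr0 b') -def_b'; ring.
have by1 : near b (b + e%:R).
  by apply/nearP; exists (2 * e)%N => //; ring.
have by1' : near b' (b + e%:R).
  apply/nearP; exists j; first exact: ltnW.
  have -> : b + e%:R + e%:R = b + (e + 1)%:R + e%:R - 1 by ring.
  by rewrite def_b'; ring.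
have [_ eq_b] := tiling_unique tilP Pab Pab' ax by1 ax' by1'.
(* [b = b'] would force [w = j + 1] in [Z_q], hence in the naturals, although
   [j + 1 <= 2e]. *)
have wq := width_lt_modulus.
have eq_j : w = j.+1.
  apply: natr_inj_lt; [by lia | by lia | ].
  by apply: (addrI b); rewrite {2}eq_b -def_b'; ring.
by lia.
Qed.

Lemma column_translate (x a b : 'Z_q) (s : nat) :
  P a b -> near a x -> exists2 a', P a' (b + (w * s)%:R) & near a' x.
Proof.
move=> Pab ax; elim: s => [|s [a' Pab' ax']].
  by exists a; rewrite ?muln0 ?addr0.
have [a2 Pab2 ax2] := column_step Pab' ax'; exists a2 => //.
by rewrite mulnSr natrD addrA.
Qed.

(** The translates of one square along the line already cover [b'], so the
    square centred at height [b'] is one of them. *)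
Lemma column_congr (x a b a' b' : 'Z_q) :
  P a b -> P a' b' -> near a x -> near a' x -> congr_width b b'.
Proof.
move=> Pab Pab' ax ax'; have [s near_b'] := near_some_translate b b'.
have [a2 Pab2 ax2] := column_translate s Pab ax.
have [_ <-] := tiling_unique tilP Pab2 Pab' ax2 near_b' ax' (near_refl b').
by apply/congr_widthP; exists s%:R; rewrite natrM.
Qed.

End Columns.

(** * Alignment of the squares along one axis *)

Definition congr_first (P : rel 'Z_q) : Prop :=
  forall a b a' b', P a b -> P a' b' -> congr_width a a'.

(** Either two adjacent vertical lines carry different cosets, and the line of
    separation forces all squares to be aligned horizontally, or the coset is
    carried unchanged from each vertical line to the next. *)
Lemma congr_first_or_second (P : rel 'Z_q) : square_tiling P ->
  congr_first P \/ congr_first (fun x y => P y x).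
Proof.
move=> tilP; pose fault (x : 'Z_q) := [exists c, [exists d,
  [&& P c.1 c.2, P d.1 d.2, near c.1 x, near d.1 (x + 1)
    & ~~ congr_width c.2 d.2]]].
have [/existsP[x /existsP[[a b] /existsP[[a' b'] /= faultx]]]|nofault] :=
  boolP [exists x, fault x].
  left; case/and5P: faultx => Pab Pab' ax ax' /negP ncong.
  (* A square meeting both lines would make the two cosets agree. *)
  have edge c d : P c d -> near c x -> c = x - e%:R.
    move=> Pcd cx; have /nearP[j le_j def_x] := cx.
    case: (ltnP j (2 * e)) => [lt_j|ge_j].
      case: ncong; apply: (congr_width_trans (column_congr tilP Pab Pcd ax cx)).
      apply: (column_congr tilP Pcd Pab' _ ax'); apply/nearP; exists j.+1 => //.
      by rewrite addrAC def_x -natr1 addrA.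
    have {}le_j : j = (2 * e)%N by lia.
    by rewrite -[LHS](addrK j%:R) -def_x le_j; ring.
  (* Follow the horizontal line of height [d] to the line of separation. *)
  have all_edge c d : P c d -> congr_width (x - e%:R) c.
    move=> Pcd; have [c' [d' [Pcd' cx' dy']]] := tiling_cover tilP x d.
    rewrite -(edge _ _ Pcd' cx').
    exact: (column_congr (square_tiling_swap tilP) Pcd' Pcd dy' (near_refl d)).
  move=> c d c' d' Pcd Pcd'; apply: congr_width_trans (all_edge _ _ Pcd').
  by rewrite congr_width_sym; apply: all_edge Pcd.
right=> b a b' a' /= Pab Pab'.
have walk (n : nat) c d : P c d -> near c (a + n%:R) -> congr_width b d.
  elim: n c d => [|n IHn] c d Pcd.
    by rewrite addr0; apply: (column_congr tilP Pab Pcd (near_refl a)).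
  rewrite -natr1 addrA => near_c.
  have [c' [d' [Pcd' near_c' _]]] := tiling_cover tilP (a + n%:R) 0.
  apply: (congr_width_trans (IHn _ _ Pcd' near_c')).
  apply: contraR nofault => ncong; apply/existsP; exists (a + n%:R).
  apply/existsP; exists (c', d'); apply/existsP; exists (c, d).
  by apply/and5P.
apply: (walk (a' - a) a') => //.
by rewrite natr_Zp addrC subrK near_refl.
Qed.

(** The value [h k] is the height of any centre on the line [a + w k]; there is
    one because the square covering a point of this line is centred on it. *)
Lemma congr_first_param (P : rel 'Z_q) : square_tiling P -> congr_first P ->
  exists (a : 'Z_q) (h : 'Z_t -> 'Z_q), forall x y,
    P x y <-> exists k s : 'Z_t, x = a + scale e q k /\ y = h k + scale e q s.
Proof.
move=> tilP congP; have [a [b [Pab _ _]]] := tiling_cover tilP 0 0.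
pose h (k : 'Z_t) := odflt 0 [pick y | P (a + scale e q k) y].
have Ph (k : 'Z_t) : P (a + scale e q k) (h k).
  rewrite /h; case: pickP => //= noP.
  have [c [d [Pcd cx _]]] := tiling_cover tilP (a + scale e q k) 0.
  suff eq_c : c = a + scale e q k by rewrite -eq_c in noP; rewrite noP in Pcd.
  apply: near_congr_width_eq => //.
  apply: (congr_width_trans (congP _ _ _ _ Pcd Pab)).
  by apply/congr_width_scale; exists k.
exists a, h => x y; split=> [Pxy|[k [s [-> ->]]]].
  have /congr_width_scale[k def_x] := congP _ _ _ _ Pab Pxy.
  rewrite def_x in Pxy *.
  have /congr_width_scale[s ->] :=
    column_congr tilP (Ph k) Pxy (near_refl _) (near_refl _).
  by exists k, s.
have [c Pc cx] := column_translate tilP s (Ph k) (near_refl _).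
by rewrite -(near_congr_width_eq cx (congP _ _ _ _ Pc (Ph k))).
Qed.

(** * From perfect codes to tilings *)

Lemma point2_surj (v : 'rV['Z_q]_2) : v = point2 (v ord0 ord0) (v ord0 ord_max).
Proof.
by apply/rowP=> -[[|[|//]] lt_i]; rewrite mxE /=; congr (v _ _); apply: val_inj.
Qed.

Lemma in_maxball_point2 (a b x y : 'Z_q) :
  (point2 x y \in maxball (point2 a b) e) = near a x && near b y.
Proof. by rewrite inE /maxdist !big_ord_recl big_ord0 !mxE /= maxn0 geq_max. Qed.

Lemma perfect_code_tiling (C : {set 'rV['Z_q]_2}) :
  perfect_code e C -> square_tiling (fun x y => point2 x y \in C).
Proof.
case=> _ cover disj; split=> [x y|a b a' b' x y Cab Cab' ax bx ax' bx'].
  have: point2 x y \in \bigcup_(c in C) maxball c e by rewrite cover inE.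
  case/bigcupP=> c; rewrite (point2_surj c) => Cc.
  rewrite in_maxball_point2 => /andP[? ?].
  by exists (c ord0 ord0), (c ord0 ord_max).
have [/rowP eq_ab|ne_ab] := eqVneq (point2 a b) (point2 a' b').
  by have := eq_ab ord0; have := eq_ab ord_max; rewrite !mxE /= => -> ->.
have /pred0P/(_ (point2 x y)) := disj _ _ Cab Cab' ne_ab.
by rewrite /= !in_maxball_point2 ax bx ax' bx'.
Qed.

End SquareTilings.

Theorem corollary3p6 (e t q : nat) (ht : (1 < t)%N)
    (hq : q = ((2 * e + 1) * t)%N) (C : {set 'rV['Z_q]_2}) :
  perfect_code e C ->
  exists (a : 'Z_q) (h : 'Z_t -> 'Z_q), C = code1 e a h \/ C = code2 e a h.
Proof.
move=> /perfect_code_tiling tilC.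
have [congC|congC] := congr_first_or_second ht hq tilC.
  have [a [h defC]] := congr_first_param ht hq tilC congC; exists a, h; right.
  apply/setP=> v; rewrite (point2_surj v).
  apply/idP/imset2P => [/defC[k [s [-> ->]]]|[k s _ _ ->]]; first by exists k s.
  by apply/defC; exists k, s.
have [a [h defC]] := congr_first_param ht hq (square_tiling_swap tilC) congC.
exists a, h; left; apply/setP=> v; rewrite (point2_surj v).
apply/idP/imset2P => [/defC[k [s [-> ->]]]|[k s _ _ ->]]; first by exists k s.
by apply/defC; exists k, s.
Qed.
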